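(* Let $(X,\|\cdot\|,\preceq)$ be a partially ordered Banach space, with order induced by a cone $P$, that has the upper comparable property. Let $S$ be a nonempty, closed, convex and bounded subset of $X$. Let $A:X\to X$ and $B:S\to X$ be two operators satisfying: (a) there exist a generalized altering distance function $\psi:[0,\infty)\to[0,\infty)$, an upper semi-continuous function $\theta:[0,\infty)\to[0,\infty)$ and a lower semi-continuous function $\varphi:[0,\infty)\to[0,\infty)$ with $\theta(0)=\varphi(0)=0$ and $\psi(t)-\theta(t)+\varphi(t)>0$ for all $t>0$, such that $$\psi(\|Ax-Ay\|)\le \theta(\|x-y\|)-\varphi(\|x-y\|)\quad\text{for all } x,y\in X \text{ with } x\succeq y;$$ (b) there exists $x_0\in X$ with $x_0\preceq Ax_0$; (c) $A$ is continuous and non-decreasing with respect to $\preceq$, and $(I-A)^{-1}$ exists and is continuous; (d) $B$ is continuous and $B(S)$ is contained in a compact subset of the cone $P$; (e) for every $y\in S$ and $x\in X$, if $x=Ax+By$ then $x\in S$. Then the operator $A+B$ has a fixed point in $S$, i.e. there exists $z^*\in S$ with $Az^*+Bz^*=z^*$.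
   Context: $X$ is a real Banach space. A cone $P\subseteq X$ is a subset that is closed, nonempty, $P\neq\{0\}$, satisfies $\alpha x+\beta y\in P$ for all $x,y\in P$ and all reals $\alpha,\beta\ge 0$, and $P\cap(-P)=\{0\}$; it is assumed that $P$ has nonempty interior. The partial order is defined by $x\preceq y$ iff $y-x\in P$ (and $x\succeq y$ means $y\preceq x$); the paper refers to $P$ as the positive cone. The partially ordered Banach space $(X,\|\cdot\|,\preceq)$ has the upper comparable property if for every $x,y\in X$ there exists $z\in X$ with $x\preceq z$ and $y\preceq z$. A function $\psi:[0,\infty)\to[0,\infty)$ is a generalized altering distance function if it is lower semi-continuous and non-decreasing, and $\psi(t)=0$ if and only if $t=0$. $I$ denotes the identity operator on $X$. *)

(* Defs.v *)
From HB Require Import structures.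
From mathcomp Require Import all_boot all_order all_algebra.
From mathcomp Require Import all_classical all_reals all_analysis.
Set Implicit Arguments. Unset Strict Implicit. Unset Printing Implicit Defensive.
Import Order.TTheory GRing.Theory Num.Theory.
Import numFieldNormedType.Exports.
Local Open Scope classical_set_scope.
Local Open Scope ring_scope.

Definition is_cone (R : realType) (X : normedModType R) (P : set X) : Prop :=
  closed P /\ P !=set0 /\ P <> [set 0] /\
  (forall (x y : X) (a b : R), P x -> P y -> 0 <= a -> 0 <= b -> P (a *: x + b *: y)) /\
  (forall x : X, P x -> P (- x) -> x = 0) /\
  (interior P) !=set0.

Definition cone_le (R : realType) (X : normedModType R) (P : set X) (x y : X) : Prop :=
  P (y - x).

Definition upper_comparable (R : realType) (X : normedModType R) (P : set X) : Prop :=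
  forall x y : X, exists z : X, cone_le P x z /\ cone_le P y z.

Definition lsc_nonneg (R : realType) (f : R -> R) : Prop :=
  forall t, 0 <= t -> forall e, 0 < e -> exists2 d, 0 < d &
    forall s, 0 <= s -> `|s - t| < d -> f t - e < f s.

Definition usc_nonneg (R : realType) (f : R -> R) : Prop :=
  forall t, 0 <= t -> forall e, 0 < e -> exists2 d, 0 < d &
    forall s, 0 <= s -> `|s - t| < d -> f s < f t + e.

Definition maps_nonneg (R : realType) (f : R -> R) : Prop :=
  forall t, 0 <= t -> 0 <= f t.

Definition gen_altering_distance (R : realType) (psi : R -> R) : Prop :=
  maps_nonneg psi /\ lsc_nonneg psi /\
  (forall s t, 0 <= s -> s <= t -> psi s <= psi t) /\
  (forall t, 0 <= t -> (psi t = 0 <-> t = 0)).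

(* Main.v *)
(* Since I - A has a continuous inverse g, a point z of S is fixed by A + B iff
   it is fixed by T := g o B. Condition (e) says that T maps S into S, and T is
   continuous with image in the compact set g(K), so Schauder's theorem applies.

   Schauder's theorem is reduced to Brouwer's theorem on a simplex by Schauder
   projections. Brouwer's theorem is obtained from Scarf's lemma: for a finite
   set with linear orders indexed by I, call a set D dominant if every y is, in
   some order, below all of D. A dominant set with |I| - 1 elements (a door)
   extends to a dominant set with |I| elements (a room) in exactly two ways,
   except at the boundary; a Sperner-type parity count then gives a room that
   carries all the colors. On the grid points of a simplex, ordered by their
   coordinates, rooms have small diameter, so no triangulation is needed. *)
Require Import Defs.
From HB Require Import structures.
From mathcomp Require Import all_boot all_order all_algebra.
From mathcomp Require Import zify.
Set Implicit Arguments. Unset Strict Implicit. Unset Printing Implicit Defensive.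

(** * Scarf's lemma *)

Section Dominant.
Variables (V I : finType) (r : I -> V -> nat).
Hypothesis r_inj : forall i, injective (r i).

Definition dominant (D : {set V}) : bool :=
  [forall y, exists i, forall x in D, r i y <= r i x].

Lemma dominantP (D : {set V}) :
  reflect (forall y, exists i, forall x, x \in D -> r i y <= r i x) (dominant D).
Proof.
apply: (iffP forallP) => H y; have := H y.
  by move=> /existsP[i /forall_inP Hi]; exists i.
by case=> i Hi; apply/existsP; exists i; apply/forall_inP.
Qed.

Lemma dominantS (D E : {set V}) : D \subset E -> dominant E -> dominant D.
Proof.
move=> /subsetP DE /dominantP domE; apply/dominantP => y.
by have [i Hi] := domE y; exists i => x /DE; apply: Hi.
Qed.

Section Door.
Variables (D : {set V}) (m : I -> V).
Hypothesis domD : dominant D.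
Hypothesis cardD : #|D|.+1 = #|I|.
Hypothesis mD : forall i, m i \in D.
Hypothesis m_min : forall i x, x \in D -> r i (m i) <= r i x.

(** Candidates to take over the minimum in the order [j]: adding one leaves the other minima in
    place, and if [D] is dominant it lies below all of [D] in the order [j]. *)
Definition beyond (j : I) : {set V} :=
  [set y | [forall i, (i != j) ==> (r i (m i) < r i y)]].

Definition best_beyond (j : I) : {set V} :=
  [set x in beyond j | [forall y in beyond j, r j y <= r j x]].

Lemma in_beyond j y :
  reflect (forall i, i != j -> r i (m i) < r i y) (y \in beyond j).
Proof. by rewrite inE; apply: (iffP forall_inP). Qed.

Lemma card_best_beyond j : #|best_beyond j| = (beyond j != set0).
Proof.
have [b0|/set0Pn[y0 y0b]] := eqVneq (beyond j) set0; last first.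
  case: (@arg_maxnP _ y0 (mem (beyond j)) (r j) y0b) => x xb xmax.
  suff -> : best_beyond j = [set x] by rewrite cards1.
  apply/setP => z; rewrite in_set1 inE; apply/andP/eqP => [[zb /forall_inP zm]|->].
    by apply: (@r_inj j); apply/eqP; rewrite eqn_leq zm// andbT; exact: xmax.
  by split=> //; apply/forall_inP.
apply/eqP; rewrite cards_eq0; apply/eqP/setP => z.
by rewrite inE b0 !inE.
Qed.

Lemma door_min_eq x i : x \in D -> (forall x', x' \in D -> r i x <= r i x') ->
  m i = x.
Proof.
by move=> xD xmin; apply: (@r_inj i); apply/eqP; rewrite eqn_leq m_min// xmin.
Qed.

Lemma door_min_surj x : x \in D -> exists i, m i = x.
Proof.
move=> xD; have /dominantP/(_ x)[i Hi] := domD.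
by exists i; exact: door_min_eq.
Qed.

(** Pigeonhole. If [D] is dominant, [a] and [b] are the only orders whose minimum can be taken over
    without leaving an element of [D] minimal in no order. *)
Lemma door_twin : exists a b, a != b /\ m a = m b.
Proof.
have /injectivePn[a [b ab mab]] : ~~ injectiveb m; last by exists a, b.
apply/negP => /injectiveP minj; have : #|m @: setT| <= #|D|.
  by apply: subset_leq_card; apply/subsetP => _ /imsetP[i _ ->].
by rewrite card_imset// cardsT -cardD ltnn.
Qed.

Variables a b : I.
Hypothesis ab : a != b.
Hypothesis mab : m a = m b.

(** An element of [D] in [beyond j] could be the minimum in the order [j] only, but that minimum is
    shared with the twin order. *)
Lemma beyond_notin j : (j == a) || (j == b) -> forall x, x \in beyond j -> x \notin D.
Proof.
move=> jab x /in_beyond xb; apply/negP => xD.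
have [k mk] := door_min_surj xD.
have xbN i : i != j -> m i <> x by move=> /xb + mix; rewrite mix ltnn.
have kj : k = j by apply/eqP; apply: contraT => /xbN.
move: jab; rewrite -kj => /orP[] /eqP kab.
  by apply: (xbN b); rewrite -?mab -?kab// -kj kab eq_sym.
by apply: (xbN a); rewrite ?mab -?kab// -kj kab.
Qed.

(** A [y] in [beyond j] is below [D] in the order [j] only, and below [x] there by maximality. Any
    other [y] is at most some [m i] with [i != j], and [x] lies above that minimum. *)
Lemma best_beyond_room j : (j == a) || (j == b) -> forall x, x \in best_beyond j ->
  dominant (x |: D).
Proof.
move=> jab x /setIdP[xb /forall_inP xbest]; apply/dominantP => y.
have /dominantP/(_ y)[i0 Hi0] := domD.
have [yb|] := boolP (y \in beyond j).
  have i0j : i0 = j.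
    apply/eqP; apply: contraT => ij; have /in_beyond/(_ _ ij) := yb.
    by rewrite ltnNge Hi0.
  exists j => z; rewrite in_setU1 => /orP[/eqP ->|zD]; first exact: xbest.
  by rewrite -{}i0j; exact: Hi0.
rewrite inE negb_forall => /existsP[i]; rewrite negb_imply -leqNgt => /andP[ij yi].
exists i => z; rewrite in_setU1 => /orP[/eqP ->|zD].
  by apply: (leq_trans yi); apply: ltnW; apply/in_beyond: ij.
exact: leq_trans yi (m_min _ zD).
Qed.

(** [J] collects the orders whose minimum survives the arrival of [x]. Each element of [D] needs
    such an order and [x] needs one outside [J], so by counting [J] is the complement of a single
    [j] and [m] is injective on it. Hence [j] is [a] or [b]. *)
Lemma room_best_beyond x : x \notin D -> dominant (x |: D) ->
  x \in best_beyond a :|: best_beyond b.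
Proof.
move=> xD /dominantP domx.
have [j Hj] := domx x.
pose J := [set i | r i (m i) < r i x].
have mJ : D \subset m @: J.
  apply/subsetP => z zD; have [i Hi] := domx z.
  have miz : m i = z.
    by apply: door_min_eq => // x' x'D; apply: Hi; rewrite in_setU1 x'D orbT.
  rewrite -miz; apply: imset_f; rewrite inE miz ltn_neqAle Hi ?setU11// andbT.
  by apply/negP => /eqP/r_inj zx; move: xD; rewrite -zx zD.
have jJ : j \notin J by rewrite inE -leqNgt Hj// in_setU1 mD orbT.
have cJ : #|D| <= #|J| by exact: leq_trans (subset_leq_card mJ) (leq_imset_card _ _).
have JE : J = [set~ j].
  apply/eqP; rewrite eqEcard cardsC1 -cardD cJ andbT.
  by apply/subsetP => i iJ; rewrite !inE; apply: contraNneq jJ => <-.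
have mJinj : {in J &, injective m}.
  apply/imset_injP; rewrite eqn_leq leq_imset_card/= {1}JE cardsC1 -cardD.
  exact: subset_leq_card.
have jab : (j == a) || (j == b).
  apply/norP => -[ja jb]; have := mJinj a b.
  by rewrite JE !inE !(eq_sym _ j) => /(_ ja jb mab)/eqP; rewrite (negPf ab).
suff xb : x \in best_beyond j.
  by move: xb; case/orP: jab => /eqP ->; rewrite in_setU => ->; rewrite ?orbT.
rewrite inE; apply/andP; split.
  by apply/in_beyond => i ij; have : i \in J; [rewrite JE !inE | rewrite inE].
apply/forall_inP => y /in_beyond yb; have [i Hi] := domx y.
have [<-|ij] := eqVneq i j; first by apply: Hi; rewrite setU11.
by have := yb i ij; rewrite ltnNge Hi// in_setU1 mD orbT.
Qed.

Lemma best_beyond_disjoint : [disjoint best_beyond a & best_beyond b].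
Proof.
apply/pred0P => x /=; apply/negP => /andP[/setIdP[xa _] /setIdP[xb _]].
have /dominantP/(_ x)[i Hi] := domD.
have [ia|ia] := eqVneq i a; last first.
  by have /in_beyond/(_ i ia) := xa; rewrite ltnNge Hi.
have ib : i != b by rewrite ia.
by have /in_beyond/(_ i ib) := xb; rewrite ltnNge Hi.
Qed.

Lemma card_rooms_of_door :
  #|[set x | (x \notin D) && dominant (x |: D)]| =
  (beyond a != set0) + (beyond b != set0).
Proof.
rewrite -!card_best_beyond.
have -> : [set x | (x \notin D) && dominant (x |: D)] =
          best_beyond a :|: best_beyond b.
  apply/setP => x; rewrite inE; apply/andP/idP => [[]|].
    exact: room_best_beyond.
  rewrite in_setU => /orP[] xb; split.
  - by case/setIdP: xb => xb _; apply: (@beyond_notin a); rewrite ?eqxx.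
  - by apply: (best_beyond_room _ xb); rewrite eqxx.
  - by case/setIdP: xb => xb _; apply: (@beyond_notin b); rewrite ?eqxx ?orbT.
  - by apply: (best_beyond_room _ xb); rewrite eqxx orbT.
by rewrite cardsU (eqP (_ : #|_ :&: _| == 0)) ?subn0// cards_eq0 setI_eq0
   best_beyond_disjoint.
Qed.

End Door.
End Dominant.

(** * Parity of the doors of a room *)

Section Flags.
Variables (V I : finType) (c : V -> I) (i0 : I).

Definition nearly_colored (D : {set V}) : bool :=
  (#|D|.+1 == #|I|) && (c @: D == [set~ i0]).

(** Suppose [E :\ x] carries every color but [i0]. As [E] misses a color, [c x] is not [i0], so it
    repeats the color of exactly one other [x']. Only the removal of [x] or [x'] loses no color: the
    count is 0 or 2. *)
Lemma even_facets (E : {set V}) : #|E| = #|I| -> c @: E != setT ->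
  ~~ odd #|[set x in E | nearly_colored (E :\ x)]|.
Proof.
move=> cardE cE; set F := [set _ in _ | _].
have [->|/set0Pn[x]] := eqVneq F set0; first by rewrite cards0.
rewrite inE => /andP[xE /andP[cardx /eqP cx]].
have cinj : {in E :\ x &, injective c}.
  apply/imset_injP/eqP; rewrite cx cardsC1; have := eqP cardx; lia.
have cxi0 : c x != i0.
  apply: contraNneq cE => cxi0; apply/eqP/setP => i; rewrite inE.
  have [->|ii0] := eqVneq i i0; first by rewrite -cxi0; exact: imset_f.
  have : i \in c @: (E :\ x) by rewrite cx !inE.
  by case/imsetP => y /setD1P[_ yE] ->; exact: imset_f.
have [x' x'E cxx'] : exists2 x', x' \in E :\ x & c x = c x'.
  by apply/imsetP; rewrite cx !inE.
have xx' : x != x' by move: x'E => /setD1P[]; rewrite eq_sym.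
suff -> : F = [set x; x'] by rewrite cards2 xx'.
have x'E' : x' \in E by case/setD1P: x'E.
apply/setP => y; rewrite !inE; apply/idP/idP => [|/orP[]/eqP ->]; last 2 first.
- by rewrite xE /nearly_colored cardx cx eqxx.
- rewrite x'E' /nearly_colored/=; apply/andP; split.
    by have := cardE; rewrite (cardsD1 x' E) x'E' => <-.
  rewrite -cx; apply/eqP/setP => i; apply/imsetP/imsetP => -[z /setD1P[zx zE] ->].
    have [zx'|zx'] := eqVneq z x; last by exists z => //; apply/setD1P.
    by exists x' => //; rewrite zx'.
  have [zx'|zx'] := eqVneq z x'; last by exists z => //; apply/setD1P.
  by exists x; [apply/setD1P | rewrite zx'].
move=> /and3P[yE _ /eqP cy].
apply: contraT => /norP[yx yx'].
have : c y \in c @: (E :\ y).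
  rewrite cy -cx; apply: imset_f; exact/setD1P.
move=> /imsetP[z /setD1P[zy zE]].
have yEx : y \in E :\ x by exact/setD1P.
have [->|zx] := eqVneq z x; first by rewrite cxx' => /cinj yx''; rewrite yx''// eqxx in yx'.
move=> /cinj yz; move: zy; rewrite yz ?eqxx//; exact/setD1P.
Qed.


(** Double counting of incidences: a door [D] with an added [x] is the same as the room [x |: D]
    with [x] marked. *)
Lemma sum_flags (dom : pred {set V}) :
  \sum_(D | nearly_colored D) #|[set x | (x \notin D) && dom (x |: D)]| =
  \sum_(E | dom E && (#|E| == #|I|)) #|[set x in E | nearly_colored (E :\ x)]|.
Proof.
under eq_bigr do rewrite -sum1dep_card.
under [RHS]eq_bigr do rewrite -sum1dep_card.
rewrite !pair_big_dep/=.
rewrite (reindex_onto (fun p => (p.1 :\ p.2, p.2)) (fun p => (p.2 |: p.1, p.2)))/=.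
  apply: eq_bigl => -[E x]/=; rewrite setD11/= xpair_eqE eqxx andbT.
  have [xE|xE] := boolP (x \in E); last first.
    rewrite !andbF; apply/negbTE; rewrite negb_and; apply/orP; right.
    by apply: contraNneq xE => <-; rewrite setU11.
  rewrite setD1K// eqxx !andbT/= andbC -!andbA; congr andb.
  rewrite /nearly_colored (cardsD1 x E) xE add1n.
  by case: (_.+1 == _).
move=> [D x]/= /and3P[_ xD _]; congr pair.
by rewrite setU1K.
Qed.

End Flags.

(** * A fully colored room *)

Section Scarf.
Variables (T I : finType) (rho : I -> T -> nat) (c : T -> I).
Hypothesis rho_inj : forall i, injective (rho i).
Hypothesis T_gt0 : 0 < #|T|.
Hypothesis I_gt1 : 1 < #|I|.

(* The slack element [inr i] is the least element of the order [i] and lies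
   above all of [T] in the other orders. *)
Let slack_base := (\max_i \max_t rho i t).+2.
Let r (i : I) (v : T + I) : nat :=
  match v with
  | inl t => (rho i t).+1
  | inr k => if k == i then 0 else slack_base + enum_rank k
  end.
Let color (v : T + I) : I := match v with inl t => c t | inr i => i end.

Let slack_above i t k : k != i -> r i (inl t) < r i (inr k).
Proof.
move=> ki; rewrite /= (negPf ki) /slack_base.
have := leq_bigmax (F := rho i) t.
have := leq_bigmax (F := fun i => \max_t rho i t) i => /=.
lia.
Qed.

Let slack_least i v : v != inr i -> r i (inr i) < r i v.
Proof.
rewrite /= eqxx; case: v => [//|k] /= kinr.
by rewrite ifN//; apply: contra_neq kinr => ->.
Qed.

Let r_inj i : injective (r i).
Proof.
move=> [s|j] [t|k].
- by case=> /rho_inj ->.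
- have [->|ki] := eqVneq k i; first by rewrite /= eqxx.
  by have := slack_above s ki => /[swap] ->; rewrite ltnn.
- have [->|ji] := eqVneq j i; first by rewrite /= eqxx.
  by have := slack_above t ji => /[swap] ->; rewrite ltnn.
have [->|ki] := eqVneq k i; have [->|ji] := eqVneq j i => //.
- by move=> H; have := @slack_least i (inr j); rewrite H ltnn => /contraFeq ->.
- by move=> H; have := @slack_least i (inr k); rewrite H ltnn => /contraFeq ->.
by rewrite /= (negPf ki) (negPf ji) => /addnI/ord_inj/enum_rank_inj ->.
Qed.

Let door_mins (D : {set T + I}) : D != set0 -> exists m : I -> T + I,
  (forall i, m i \in D) /\ (forall i x, x \in D -> r i (m i) <= r i x).
Proof.
move=> /set0Pn[x0 x0D]; exists (fun i => [arg min_(x < x0 in D) r i x]).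
by split=> i; case: arg_minnP => // x xD xmin y /xmin.
Qed.

(** The boundary door: the only nearly colored set that lies in an odd number of rooms. *)
Let start (i0 : I) : {set T + I} := [set inr i | i in [set~ i0]].

Let start_dominant i0 : dominant r (start i0).
Proof.
apply/dominantP => -[t|k].
  exists i0 => _ /imsetP[k + ->]; rewrite !inE => ki; apply: ltnW.
  exact: slack_above.
exists k => x _; have [->//|] := eqVneq x (inr k) => /slack_least; exact: ltnW.
Qed.

Let card_start i0 : #|start i0|.+1 = #|I|.
Proof. by rewrite card_imset ?cardsC1 ?prednK//; [lia | move=> ? ? []]. Qed.

Let start_colored i0 : nearly_colored color i0 (start i0).
Proof.
by rewrite /nearly_colored card_start eqxx -imset_comp/= imset_id eqxx.
Qed.

Let rooms (D : {set T + I}) := [set x | (x \notin D) && dominant r (x |: D)].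

(** The minimum in each order [k != i0] is [inr k], so the twin orders are [i0] and some [j]. Every
    [inl t] is in [beyond i0], whereas [beyond j] is empty: it asks for elements above [inr j] in
    the order [i0], which excludes [T], and no slack element qualifies. *)
Let start_rooms i0 : #|rooms (start i0)| = 1.
Proof.
have start0 : start i0 != set0 by rewrite -card_gt0; have := card_start i0; lia.
have [m [mD mmin]] := door_mins start0.
have [a [b [ab mab]]] := door_twin (card_start i0) mD.
rewrite (card_rooms_of_door r_inj (start_dominant i0) (card_start i0) mD mmin ab mab).
have mk k : k != i0 -> m k = inr k.
  move=> ki; have := mmin k (inr k); rewrite imset_f ?inE// => /(_ isT).
  by apply: contraTeq => /slack_least; rewrite ltnNge.
have t0 : T by have /card_gt0P/sigW[] := T_gt0.
have beyond_start : beyond r m i0 != set0.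
  apply/set0Pn; exists (inl t0); apply/in_beyond => i ii0.
  by rewrite mk//; exact: slack_least.
have beyond_other j : j != i0 -> m j = m i0 -> beyond r m j = set0.
  move=> ji0 mji; apply/setP => y; rewrite in_set0; apply/negP => /in_beyond yb.
  have := yb i0; rewrite -mji mk// eq_sym => /(_ ji0).
  case: y yb => [t|k] yb; first by rewrite ltnNge ltnW// slack_above.
  have [->|ki] := eqVneq k i0; first by rewrite /= eqxx.
  have [->|kj] := eqVneq k j; first by rewrite ltnn.
  by have := yb k kj; rewrite mk// ltnn.
have [ai|ai] := eqVneq a i0.
  by rewrite ai beyond_start (beyond_other b) ?eqxx// -?mab -?ai// eq_sym.
have [bi|bi] := eqVneq b i0.
  by rewrite bi beyond_start (beyond_other a) ?eqxx// mab bi.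
by move: mab; rewrite !mk// => -[] /eqP; rewrite (negPf ab).
Qed.

(** A nearly colored set of slack elements alone is [start i0], so [D] contains some [inl t]. Then
    [inr j] is in [beyond j] for every [j], and a dominant [D] has two rooms; otherwise it has
    none. *)
Let inner_rooms i0 D : nearly_colored color i0 D -> D != start i0 ->
  ~~ odd #|rooms D|.
Proof.
move=> /andP[/eqP cardD /eqP colD] Dstart.
have [domD|ndomD] := boolP (dominant r D); last first.
  suff -> : rooms D = set0 by rewrite cards0.
  apply/setP => x; rewrite !inE; apply/negP => /andP[_].
  by move/(dominantS (subsetUr _ _)); apply/negP.
have [t tD] : exists t, inl t \in D.
  apply/existsP; apply: contraNT Dstart => /existsPn noT.
  rewrite eqEcard (_ : D \subset _) => [/=|].
    by rewrite -ltnS cardD card_start.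
  apply/subsetP => -[t tD|k kD]; first by have := noT t; rewrite tD.
  by apply: imset_f; rewrite -colD; apply/imsetP; exists (inr k).
have D0 : D != set0 by apply/set0Pn; exists (inl t).
have [m [mD mmin]] := door_mins D0.
have [a [b [ab mab]]] := door_twin cardD mD.
rewrite (card_rooms_of_door r_inj domD cardD mD mmin ab mab).
have beyond_slack j : beyond r m j != set0.
  apply/set0Pn; exists (inr j); apply/in_beyond => i ij.
  by apply: leq_ltn_trans (mmin i _ tD) _; apply: slack_above; rewrite eq_sym.
by rewrite !beyond_slack.
Qed.

(** Were no room fully colored, each would have an even number of nearly colored doors, yet
    [start i0] makes the number of incidences odd. *)
Lemma scarf : exists (s : {set T}) (C : {set I}),
  (forall y, exists2 i, i \in C & forall x, x \in s -> rho i y <= rho i x) /\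
  (forall i, i \in C -> exists2 x, x \in s & c x = i).
Proof.
have /card_gt0P[i0 _] : 0 < #|I| by exact: ltnW.
have /existsP[E /andP[domE /eqP colE]] :
    [exists E, dominant r E && (color @: E == setT)].
  apply: contraT => /existsPn noE.
  have : odd (\sum_(D | nearly_colored color i0 D) #|rooms D|).
    rewrite (bigD1 (start i0))//= start_rooms oddD/= -dvdn2.
    apply: dvdn_sum => D /andP[colD Dstart]; rewrite dvdn2.
    exact: inner_rooms colD Dstart.
  rewrite sum_flags => /negPn/negP[]; rewrite -dvdn2; apply: dvdn_sum => E.
  move=> /andP[domE /eqP cardE]; rewrite dvdn2.
  by apply: even_facets => //; have := noE E; rewrite domE.
(* An order whose slack element is in [E] cannot put [inl y] below [E], and a color whose slack
   element is missing must come from [T]. *)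
exists [set t | inl t \in E], [set i | inr i \notin E]; split.
  move=> y; have /dominantP/(_ (inl y))[i Hi] := domE; exists i.
    by rewrite inE; apply/negP => /Hi; rewrite leqNgt slack_least.
  by move=> x; rewrite inE => /Hi.
move=> i; rewrite inE => iE.
have : i \in color @: E by rewrite colE.
case/imsetP => -[t|k] vE /= ik; first by exists t; rewrite ?inE.
by move: iE; rewrite ik vE.
Qed.

End Scarf.

From mathcomp Require Import all_classical all_reals all_analysis.
From mathcomp Require Import lra.
Import Order.TTheory GRing.Theory Num.Theory.
Import numFieldNormedType.Exports.
Local Open Scope classical_set_scope.
Local Open Scope ring_scope.

(** * Brouwer's theorem *)

Section Grid.
Local Open Scope nat_scope.
Variables n N : nat.
Let I := 'I_n.+2.
Let grid := {g : {ffun I -> 'I_N.+1} | \sum_i g i == N}.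

Let coord (t : grid) (i : I) : nat := val t i.

Let sum_coord t : \sum_i coord t i = N.
Proof. exact/eqP/(valP t). Qed.

(** The coordinate is the leading digit; [enum_rank] breaks ties to make [rho i] injective. *)
Let rho (i : I) (t : grid) : nat := coord t i * #|{: grid}| + enum_rank t.

Let rho_coord i s t : rho i s <= rho i t -> coord s i <= coord t i.
Proof.
have aux (a b p q K : nat) : q < K -> a * K + p <= b * K + q -> a <= b by nia.
exact/aux/ltn_ord.
Qed.

Let rho_inj i : injective (rho i).
Proof.
move=> s t st; apply/enum_rank_inj/ord_inj.
have sti : coord s i = coord t i :> nat.
  by apply/eqP; rewrite eqn_leq !rho_coord ?st.
by move: st; rewrite /rho sti => /addnI.
Qed.

Let grid_of (y : I -> nat) : \sum_i y i = N -> {t : grid | forall i, coord t i = y i :> nat}.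
Proof.
move=> sumy.
have yN i : y i < N.+1 by rewrite ltnS -sumy (bigD1 i)//= leq_addr.
pose g := [ffun i => Ordinal (yN i)].
have gN : \sum_i g i == N by rewrite -[eqbRHS]sumy; apply/eqP/eq_bigr => i _; rewrite ffunE.
by exists (exist _ g gN) => i; rewrite /coord/= ffunE.
Qed.

Lemma scarf_grid (c : {ffun I -> 'I_N.+1} -> I) :
  exists (s : {set {ffun I -> 'I_N.+1}}) (C : {set I}),
  [/\ s != finset.set0, forall g, g \in s -> \sum_i g i = N,
      forall i, i \in C -> exists2 g, g \in s & c g = i,
      forall g i, g \in s -> i \notin C -> g i <= n.+2 &
      forall g h i, g \in s -> h \in s -> g i <= h i + n.+2].
Proof.
have [|t0 _] := @grid_of (fun i => if i == ord0 then N else 0).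
  by rewrite -big_mkcond/= big_pred1_eq.
have grid_gt0 : 0 < #|{: grid}| by apply/card_gt0P; exists t0.
have I_gt1 : 1 < #|{: I}| by rewrite card_ord.
have [s [C [dom col]]] := scarf (fun t : grid => c (val t)) rho_inj grid_gt0 I_gt1.
have [i1 i1C _] := dom t0.
have [x0 x0s _] := col _ i1C.
pose mu (i : I) : nat := coord [arg min_(x < x0 in s) coord x i] i.
have mu_min i x : x \in s -> mu i <= coord x i.
  by rewrite /mu; case: arg_minnP => // x' _ + xs => /(_ _ xs).
(* Outside [C] the trivial bound 0 is kept, which makes those coordinates small. *)
pose l i := if i \in C then mu i else 0.
have l_min i x : x \in s -> l i <= coord x i by rewrite /l; case: ifP => // _; exact: mu_min.
(* Otherwise raise [l] by one on [C] and put the remaining weight on [i1]: this grid point exceeds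
   the minimum over [s] in every coordinate of [C], against dominance. *)
have suml : N < \sum_i l i + #|C|.
  rewrite ltnNge; apply/negP => leN.
  have sumC : \sum_i ((i \in C) : nat) = #|C| by rewrite -sum1_card [RHS]big_mkcond.
  have sum1 e : \sum_(i < n.+2) (if i == i1 then e else 0) = e.
    by rewrite -big_mkcond/= big_pred1_eq.
  pose y i := l i + (i \in C) + (if i == i1 then N - (\sum_i l i + #|C|) else 0).
  have [|t ty] := @grid_of y.
    by rewrite !big_split/= sumC sum1 subnKC.
  have [i iC it] := dom t.
  have : coord t i <= mu i.
    by rewrite /mu; case: arg_minnP => // x xs _; apply: rho_coord; exact: it.
  by rewrite ty /y /l iC; lia.
have le_card : #|C| <= n.+2 by rewrite -[leqRHS](card_ord n.+2) max_card.
(* The total excess of [x] over [l] is below [#|C|]. *)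
have upper x i : x \in s -> coord x i <= l i + n.+2.
  move=> xs; have := sum_coord x; move: suml; rewrite (bigD1 i)//= [X in X = N -> _](bigD1 i)//=.
  have : \sum_(j < n.+2 | j != i) l j <= \sum_(j < n.+2 | j != i) coord x j.
    by apply: leq_sum => j _; exact: l_min.
  move: le_card; set p := \sum_(_ < _ | _) l _; set q := \sum_(_ < _ | _) coord x _.
  by move: #|C| p q => k p q; lia.
exists [set val x | x in s]%SET, C; split.
- by apply/set0Pn; exists (val x0); exact: imset_f.
- by move=> _ /imsetP[x _ ->]; apply/eqP; exact: (valP x).
- by move=> i /col[x xs <-]; exists (val x) => //; exact: imset_f.
- by move=> _ i /imsetP[x xs ->] iC; have := upper x i xs; rewrite /l (negPf iC).
- move=> _ _ i /imsetP[x xs ->] /imsetP[y ys ->].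
  by apply: leq_trans (upper x i xs) _; rewrite leq_add2r l_min.
Qed.

End Grid.

(** Arbitrarily large indices [k] are exposed so that an error such as [k.+1%:R^-1] can be made
    small at the same time. *)
Lemma compact_seq_cluster (R : realType) (X : normedModType R) (K : set X)
    (u : nat -> X) : compact K -> (forall k, K (u k)) ->
  exists2 x, K x & forall e, 0 < e -> forall k0 : nat,
    exists2 k : nat, (k0 <= k)%N & `|x - u k| < e.
Proof.
move=> Kc Ku; have [|x [Kx clx]] := Kc (u @ \oo) _.
  by exists 0%N => // k _; exact: Ku.
exists x => // e e0 k0.
have [|_ [[k k0k <-] +]] := clx [set u k | k in [set k | (k0 <= k)%N]] (ball x e) _
  (nbhsx_ballx x e e0).
  by exists k0 => // k k0k /=; exists k.
by rewrite -ball_normE/= => ?; exists k.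
Qed.

(** * From approximate to exact fixed points on the simplex *)

Section Brouwer.
Variables (R : realType) (n : nat).
Implicit Types x y : 'rV[R]_n.+2.

Definition simplex : set 'rV[R]_n.+2 :=
  [set x | (forall i, 0 <= x ord0 i) /\ \sum_i x ord0 i = 1].

Lemma simplex_le1 x i : simplex x -> x ord0 i <= 1.
Proof.
by move=> [x0 <-]; rewrite (bigD1 i)//= lerDl sumr_ge0.
Qed.

Lemma norm_row_le x e : 0 <= e -> (forall i, `|x ord0 i| <= e) -> `|x| <= e.
Proof.
move=> e0 xe; rewrite [leLHS]/Num.norm/= mx_normrE; apply/bigmax_leP; split => //.
by move=> [i j] _ /=; rewrite ord1.
Qed.

Lemma norm_row_ge x i : `|x ord0 i| <= `|x|.
Proof.
rewrite [leRHS]/Num.norm/= mx_normrE; apply/bigmax_geP; right.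
by exists (ord0, i).
Qed.

Lemma simplex_closed : closed simplex.
Proof.
have -> : simplex = \bigcap_(i in setT) [set x : 'rV[R]_n.+2 | 0 <= x ord0 i] `&`
    (fun x : 'rV[R]_n.+2 => \sum_i x ord0 i) @^-1` [set 1].
  apply/seteqP; split => x [x0 x1]; split => // i; first by move=> _; exact: x0.
  exact: x0.
apply: closedI.
  apply: closed_bigI => i _.
  apply: (@preimage_closed _ _ (fun x : 'rV[R]_n.+2 => x ord0 i) [set z | 0 <= z]).
    by move=> x _; exact: coord_continuous.
  exact: closed_ge.
apply: preimage_closed; last exact: closed_eq.
have sum_cont : continuous (fun x : 'rV[R]_n.+2 => \sum_i x ord0 i).
  apply: continuous_big => [|i _]; first exact: add_continuous.
  exact: coord_continuous.
by move=> x _; exact: sum_cont.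
Qed.

Lemma simplex_compact : compact simplex.
Proof.
apply: bounded_closed_compact; last exact: simplex_closed.
exists 1; split => // M M1 x xs; apply: (le_trans _ (ltW M1)).
apply: norm_row_le => // i; rewrite ger0_norm ?simplex_le1//.
by case: xs.
Qed.

Variable f : 'rV[R]_n.+2 -> 'I_n.+2 -> R.
Hypothesis f_cont : forall i, {within simplex, continuous (f^~ i)}.
Hypothesis f_ge0 : forall x i, simplex x -> 0 <= f x i.
Hypothesis f_sum : forall x, simplex x -> \sum_i f x i = 1.

(** Each grid point is colored by a coordinate that [f] does not decrease. For a point of the room,
    a coordinate in [C] has a nearby point of that color, and the others are close to 0. *)
Lemma brouwer_approx (e : R) : 0 < e -> exists2 x, simplex x &
  forall i, x ord0 i <= e \/
    exists y, [/\ simplex y, `|x - y| <= e & y ord0 i <= f y i].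
Proof.
(* Chosen so that [n.+2] grid steps of length [1 / N] amount to at most [e]. *)
move=> e0; pose N := (Num.truncn (n.+2%:R / e)).+1.
have N0 : 0 < N%:R :> R by [].
have Ne : n.+2%:R <= e * N%:R :> R.
  by rewrite mulrC -ler_pdivrMr// ltW// /N truncnS_gt.
pose pt (g : {ffun 'I_n.+2 -> 'I_N.+1}) : 'rV[R]_n.+2 := \row_i ((g i)%:R / N%:R).
have ptS (g : {ffun 'I_n.+2 -> 'I_N.+1}) : (\sum_i g i = N)%N -> simplex (pt g).
  move=> gN; split=> [i|]; first by rewrite mxE divr_ge0.
  under eq_bigr do rewrite mxE.
  by rewrite -mulr_suml -natr_sum gN divff// gt_eqF.
(* On the simplex both sides sum to 1, so such an index exists and the default is not reached. *)
pose c g := odflt ord0 [pick i | pt g ord0 i <= f (pt g) i].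
have cP g : simplex (pt g) -> pt g ord0 (c g) <= f (pt g) (c g).
  move=> gS; rewrite /c; case: pickP => //= H.
  have : \sum_i f (pt g) i < \sum_i pt g ord0 i.
    by apply: ltr_sum => [|i _]; [apply/hasP; exists ord0; rewrite ?mem_index_enum | rewrite ltNge H].
  by rewrite f_sum//; case: gS => _ ->; rewrite ltxx.
have [s [C [/set0Pn[g gs] sN col small close]]] := scarf_grid c.
exists (pt g) => [|i]; first exact/ptS/sN.
have [iC|iC] := boolP (i \in C); last first.
  left; rewrite mxE ler_pdivrMr//; apply: le_trans Ne; rewrite ler_nat.
  exact: small.
right; have [h hs hi] := col i iC; exists (pt h); split.
- exact/ptS/sN.
- apply: norm_row_le => [|j]; first exact: ltW.
  rewrite !mxE -mulrBl normrM [X in _ * X]gtr0_norm ?invr_gt0//.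
  rewrite ler_pdivrMr//; apply: le_trans Ne.
  have := close g h j gs hs; have := close h g j hs gs.
  by rewrite -!(ler_nat R) !natrD ler_norml => ? ?; lra.
- by rewrite -hi; apply: cP; exact/ptS/sN.
Qed.

(** At a cluster point no coordinate is decreased by [f]; equal sums then force equality. *)
Theorem brouwer_simplex : exists2 x, simplex x & forall i, f x i = x ord0 i.
Proof.
have /choice[u uP] : forall k : nat, exists x, simplex x /\
    forall i, x ord0 i <= k.+1%:R^-1 \/
      exists y, [/\ simplex y, `|x - y| <= k.+1%:R^-1 & y ord0 i <= f y i].
  by move=> k; have [|x] := @brouwer_approx k.+1%:R^-1; [rewrite invr_gt0 | exists x].
have [x xS xu] := compact_seq_cluster simplex_compact (fun k => (uP k).1).
have le_f i : x ord0 i <= f x i.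
  rewrite leNgt; apply/negP => fx.
  have x0 : 0 < x ord0 i := le_lt_trans (f_ge0 i xS) fx.
  have [d d0 dP] : exists2 d, 0 < d & forall y, simplex y -> `|x - y| < d -> f y i < y ord0 i.
    have : (fun y => y ord0 i - f y i) @ within simplex (nbhs x) --> x ord0 i - f x i.
      apply: cvgB; first by apply: cvg_within_filter; exact: coord_continuous.
      by have /subspace_continuousP/(_ _ xS) := @f_cont i.
    move=> /cvgrPdist_lt/(_ (x ord0 i - f x i)); rewrite subr_gt0 => /(_ fx).
    rewrite near_withinE/= => /nbhs_ballP[d d0 dP]; exists d => // y yS xy.
    have := dP y; rewrite -ball_normE/= => /(_ xy yS); rewrite ltr_norml => /andP[_].
    by lra.
  (* The bound [d / 2] keeps [y] within [d] of [x] by way of [u k]; the bound [x ord0 i / 2]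
     excludes that the coordinate of [u k] is at most [k.+1%:R^-1]. *)
  have [e [e0 ed ex]] : exists e, [/\ 0 < e, e <= d / 2 & e <= x ord0 i / 2].
    exists (Num.min (d / 2) (x ord0 i / 2)).
    by rewrite lt_min !ge_min !lexx orbT !divr_gt0.
  have [k k0 xk] := xu e e0 (Num.truncn e^-1).
  have ke : k.+1%:R^-1 < e.
    rewrite invf_plt ?posrE//; apply: lt_le_trans (truncnS_gt _) _.
    by rewrite ler_nat ltnS.
  have [uS /(_ i)[ui|[y [yS uy]]]] := uP k.
    have xui : `|x ord0 i - u k ord0 i| < e.
      by apply: le_lt_trans xk; have := norm_row_ge (x - u k) i; rewrite !mxE.
    have := le_lt_trans (ler_norm _) xui; have := le_lt_trans ui ke; lra.
  apply/negP; rewrite -ltNge; apply: dP => //.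
  rewrite -(subrKA (u k)); apply: le_lt_trans (ler_normD _ _) _.
  have := le_lt_trans uy ke; lra.
exists x => // i; apply/eqP; rewrite eq_sym eq_le le_f/=.
have := f_sum xS; case: (xS) => _ <-; rewrite (bigD1 i)//= [RHS](bigD1 i)//=.
have : \sum_(j | j != i) x ord0 j <= \sum_(j | j != i) f x j by apply: ler_sum.
lra.
Qed.

End Brouwer.

(** * Schauder's theorem *)

Section Convex.
Variables (R : realType) (X : normedModType R).

Lemma convex_setP (S : set X) : convex_set S -> forall (x y : X) (t : R),
  S x -> S y -> 0 <= t -> t <= 1 -> S (t *: x + (1 - t) *: y).
Proof.
move=> cS x y t Sx Sy t0 t1.
by have := cS x y (Itv01 t0 t1); rewrite !inE; exact.
Qed.

(** The tail is normalized by its total weight [q]; if [q] is 0, all its weights vanish. *)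
Lemma convex_set_sum (S : set X) : convex_set S ->
  forall n (p : 'I_n -> X) (w : 'I_n -> R), (forall i, S (p i)) ->
  (forall i, 0 <= w i) -> \sum_i w i = 1 -> S (\sum_i w i *: p i).
Proof.
move=> cS; elim=> [|n IHn] p w pS w0 w1.
  by move/eqP: w1; rewrite big_ord0 eq_sym oner_eq0.
move: w1; rewrite !big_ord_recl; set t := w ord0; set q := \sum_i _ => tq.
have q0 : 0 <= q by exact: sumr_ge0.
have tE : 1 - t = q by rewrite -tq addrC addKr.
have [q00|qn0] := eqVneq q 0.
  rewrite big1 => [|i _]; last first.
    move: q00 => /psumr_eq0P -> //; first by rewrite scale0r.
  by move: tq; rewrite q00 !addr0 => ->; rewrite scale1r.
have -> : \sum_(i < n) w (lift ord0 i) *: p (lift ord0 i) =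
    (1 - t) *: \sum_(i < n) (w (lift ord0 i) / q) *: p (lift ord0 i).
  rewrite scaler_sumr; apply: eq_bigr => i _; rewrite scalerA; congr (_ *: _).
  by rewrite tE mulrC divfK.
apply: convex_setP => //; [|exact: w0|by rewrite -subr_ge0 tE].
apply: IHn => // [i|]; first by rewrite divr_ge0.
by rewrite -mulr_suml divff.
Qed.

Lemma compact_net (K : set X) (e : R) : compact K -> K !=set0 -> 0 < e ->
  exists n (p : 'I_n.+2 -> X), (forall i, K (p i)) /\
    forall y, K y -> exists i, `|y - p i| < e.
Proof.
rewrite compact_cover => Kc [x0 Kx0] e0.
have [|y Ky|D DK KD] := Kc X K (fun x => ball x e).
- by move=> x _; exact: ball_open.
- by exists y => //; exact: ballxx.
(* The point [x0] is listed twice to reach the index type ['I_n.+2] of [brouwer_simplex]. *)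
pose s : seq X := [:: x0, x0 & finmap.enum_fset D].
exists (size (finmap.enum_fset D)), (fun i => nth x0 s i); split=> [i|y Ky].
  have : nth x0 s i \in s by apply: mem_nth.
  by rewrite !inE => /or3P[/eqP ->|/eqP ->|/DK] //; rewrite inE.
have [x /= xD] := KD y Ky; rewrite -ball_normE/= distrC => yx.
have xs : (index x s < (size (finmap.enum_fset D)).+2)%N.
  by rewrite -[ltnRHS]/(size s) index_mem !inE; apply/or3P; constructor 3.
exists (Ordinal xs) => /=; rewrite (nth_index x0)//.
by rewrite -index_mem.
Qed.

End Convex.

(** * Schauder projections and passage to the limit *)

Section Schauder.
Variables (R : realType) (X : normedModType R) (S K : set X) (T : X -> X).
Hypothesis cS : convex_set S.
Hypothesis cK : compact K.
Hypothesis K0 : K !=set0.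
Hypothesis KS : K `<=` S.
Hypothesis T_cont : {within S, continuous T}.
Hypothesis TK : forall x, S x -> K (T x).

(** Brouwer's theorem is applied to the barycentric weights of the Schauder projection of [T (F x)].
    At a fixed point, [F x] averages the [p i] with nonzero weight only on those within [e] of
    [T (F x)]. *)
Lemma schauder_approx (e : R) : 0 < e -> exists2 z, S z & `|T z - z| <= e.
Proof.
move=> e0; have [n [p [pK pnet]]] := compact_net cK K0 e0.
pose F (x : 'rV[R]_n.+2) : X := \sum_i x ord0 i *: p i.
have FS x : simplex x -> S (F x).
  by move=> [x0 x1]; apply: convex_set_sum => // i; exact/KS/pK.
have F_cont : continuous F.
  apply: continuous_big => [|i _]; first exact: add_continuous.
  by move=> x; exact: cvgZr_tmp (@coord_continuous R 1 n.+2 ord0 i x).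
(* [h i] vanishes exactly outside the ball of radius [e] around [p i]. *)
pose h i (y : X) := `|e - `|y - p i| | + (e - `|y - p i|).
have h0 i y : 0 <= h i y by have := ler_norm (- (e - `|y - p i|)); rewrite normrN /h; lra.
have h_far i y : e <= `|y - p i| -> h i y = 0.
  by move=> ey; rewrite /h ler0_norm ?subr_le0// addNr.
have h_cont i : continuous (h i).
  have cont : continuous (fun y => e - `|y - p i|).
    move=> y; apply: cvgB; first exact: cvg_cst.
    by apply: cvg_norm; apply: cvgB; [exact: cvg_id | exact: cvg_cst].
  by move=> y; apply: cvgD; [apply: cvg_norm|]; exact: cont.
pose H y := \sum_i h i y.
have H_gt0 y : K y -> 0 < H y.
  move=> /pnet[i yi]; rewrite /H (bigD1 i)//= ltr_pwDl ?sumr_ge0//.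
  by rewrite /h ger0_norm; lra.
have H_cont : continuous H.
  apply: continuous_big => [|i _]; first exact: add_continuous.
  exact: h_cont.
pose f x i := h i (T (F x)) / H (T (F x)).
have TFK x : simplex x -> K (T (F x)) by move=> /FS/TK.
have TF_cvg x : simplex x -> T (F y) @[y --> within (@simplex R n) (nbhs x)] --> T (F x).
  move=> xs; have /subspace_continuousP/(_ _ (FS _ xs)) := T_cont.
  apply: cvg_comp => U /= FU; have /F_cont := FU.
  rewrite /within/= !nbhs_simpl/= => FU'; apply: filterS FU' => y FyU ys.
  by apply: FyU; exact: FS.
have [|x i xs|x xs|x xs xP] := @brouwer_simplex R n f.
- move=> i; apply/subspace_continuousP => x xs; apply: cvgM.
    by apply: (cvg_comp _ _ (TF_cvg x xs)); exact: h_cont.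
  apply: cvgV; first by rewrite gt_eqF// H_gt0//; exact: TFK.
  by apply: (cvg_comp _ _ (TF_cvg x xs)); exact: H_cont.
- by rewrite divr_ge0// ltW// H_gt0//; exact: TFK.
- by rewrite -mulr_suml divff// gt_eqF// H_gt0//; exact: TFK.
exists (F x); first exact: FS.
have [x0 x1] := xs.
have -> : T (F x) - F x = \sum_i x ord0 i *: (T (F x) - p i).
  under [RHS]eq_bigr do rewrite scalerBr.
  by rewrite sumrB -scaler_suml x1 scale1r.
apply: le_trans (ler_norm_sum _ _ _) _.
rewrite -[leRHS]mul1r -x1 mulr_suml; apply: ler_sum => i _.
rewrite normrZ ger0_norm//.
have [yi|yi] := leP `|T (F x) - p i| e; first exact: ler_wpM2l.
by rewrite -xP /f h_far ?(ltW yi)// !mul0r.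
Qed.

(** The cluster point is taken along the images [T (u k)], which lie in the compact [K]; the points
    [u k] are close to them. *)
Theorem schauder_convex : exists2 z, S z & T z = z.
Proof.
have /choice[u uP] : forall k : nat, exists z, S z /\ `|T z - z| <= k.+1%:R^-1.
  by move=> k; have [|z] := @schauder_approx k.+1%:R^-1; [rewrite invr_gt0 | exists z].
have [z Kz zu] := compact_seq_cluster cK (fun k => TK (uP k).1).
exists z; first exact: KS.
apply/eqP; rewrite -subr_eq0 -normr_le0; apply/ler_addgt0Pl => e e0; rewrite addr0.
have /subspace_continuousP/(_ _ (KS Kz)) := T_cont.
move=> /cvgrPdist_lt/(_ (e / 2)); rewrite divr_gt0// => /(_ isT).
rewrite near_withinE/= => /nbhs_ballP[d /= d0 dP].
(* The bound [d / 2] keeps [u k] within [d] of [z] by way of [T (u k)]; [e / 2] is the share of the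
   distance from [T (u k)] to [z]. *)
have [e' [e'0 e'd e'e]] : exists e', [/\ 0 < e', e' <= d / 2 & e' <= e / 2].
  exists (Num.min (d / 2) (e / 2)).
  by rewrite lt_min !ge_min !lexx orbT !divr_gt0.
have [k k0 zk] := zu e' e'0 (Num.truncn e'^-1).
have ke : k.+1%:R^-1 < e'.
  rewrite invf_plt ?posrE//; apply: lt_le_trans (truncnS_gt _) _.
  by rewrite ler_nat ltnS.
have [uS uk] := uP k; have {ke}uk := le_lt_trans uk ke.
have : `|T z - T (u k)| < e / 2.
  apply: dP => //; rewrite -ball_normE/= -(subrKA (T (u k))).
  by apply: le_lt_trans (ler_normD _ _) _; lra.
rewrite distrC in zk => Tz.
rewrite -(subrKA (T (u k))); apply: le_trans (ler_normD _ _) _; lra.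
Qed.

End Schauder.

(** * The fixed point of [A + B] *)

Theorem theorem3p2 (R : realType) (X : completeNormedModType R) (P : set X)
  (S : set X) (A B : X -> X) (psi theta phi : R -> R) :
  is_cone P ->
  upper_comparable P ->
  S !=set0 -> closed S -> convex_set S -> bounded_set S ->
  (* (a) *)
  gen_altering_distance psi ->
  maps_nonneg theta -> usc_nonneg theta ->
  maps_nonneg phi -> lsc_nonneg phi ->
  theta 0 = 0 -> phi 0 = 0 ->
  (forall t, 0 < t -> psi t - theta t + phi t > 0) ->
  (forall x y : X, cone_le P y x ->
     psi `|A x - A y| <= theta `|x - y| - phi `|x - y|) ->
  (* (b) *)
  (exists x0 : X, cone_le P x0 (A x0)) ->
  (* (c) *)
  continuous A ->
  (forall x y : X, cone_le P x y -> cone_le P (A x) (A y)) ->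
  (exists g : X -> X, cancel (fun x => x - A x) g /\ cancel g (fun x => x - A x)
                      /\ continuous g) ->
  (* (d) *)
  {within S, continuous B} ->
  (exists K : set X, compact K /\ K `<=` P /\ B @` S `<=` K) ->
  (* (e) *)
  (forall y x : X, S y -> x = A x + B y -> S x) ->
  exists2 z : X, S z & A z + B z = z.
Proof.
move=> _ _ [s0 Ss0] clS cS _ _ _ _ _ _ _ _ _ _ _ _ _ [g [_ [gK g_cont]]] B_cont.
move=> [K [cK [_ BK]]] AB.
have gB y : g (B y) = A (g (B y)) + B y by rewrite -[X in _ + X]gK addrC subrK.
have TS y : S y -> S (g (B y)) by move=> Sy; exact: AB Sy (gB y).
(* Intersecting with the closed [S] keeps the image of [K] under [g] compact and places it inside
   [S], as [schauder_convex] asks. *)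
have TK y : S y -> ((g @` K) `&` S) (g (B y)).
  by move=> Sy; split; [exists (B y) => //; apply: BK; exists y | exact: TS].
have [|||||z Sz Tz] := @schauder_convex R X S ((g @` K) `&` S) (g \o B) cS.
- apply: compact_closedI clS; apply: continuous_compact cK.
  exact: continuous_subspaceT.
- by exists (g (B s0)); exact: TK.
- by move=> x [].
- apply/subspace_continuousP => x Sx.
  have /subspace_continuousP/(_ _ Sx) := B_cont.
  by move=> Bx; apply: (cvg_comp _ _ Bx); exact: g_cont.
- exact: TK.
by exists z => //; have := gB z; rewrite (Tz : g (B z) = z) => <-.
Qed.
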